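(* Let $J\subset\mathbb R$ be a compact interval with nonempty interior and $\varepsilon>0$. With respect to the initial evaluation topologies on the diagonal singleton-window instance spaces, $$\mathcal P^\sigma_{J,\mathrm{diag}}\equiv_{\mathrm{cont},\mathrm{fq}}\mathcal P^{\sigma_\varepsilon}_{J,\varepsilon,\mathrm{diag}},$$ i.e. $\mathcal P^\sigma_{J,\mathrm{diag}}\le_{\mathrm{cont},\mathrm{fq}}\mathcal P^{\sigma_\varepsilon}_{J,\varepsilon,\mathrm{diag}}$ and $\mathcal P^{\sigma_\varepsilon}_{J,\varepsilon,\mathrm{diag}}\le_{\mathrm{cont},\mathrm{fq}}\mathcal P^\sigma_{J,\mathrm{diag}}$.
   Context: $\mathbb N=\{1,2,\dots\}$, $\mathbb N_0=\{0,1,2,\dots\}$. SCI computational problem: $\mathcal P=(\Xi,\Omega,(\mathcal M,d),\Lambda)$ with $\Omega$ a set, $(\mathcal M,d)$ a metric space, $\Xi:\Omega\to\mathcal M$ the target map and $\Lambda$ a set of functions $\Omega\to\mathbb C$ such that $\Xi(A)\neq\Xi(B)$ implies $f(A)\neq f(B)$ for some $f\in\Lambda$. The initial evaluation topology on $\Omega$ is the coarsest topology making all $f\in\Lambda$ continuous. Continuous finite-query transport: $\mathcal S=(\Psi,\Sigma,(\mathcal N,\rho),\Lambda_{\mathcal S})\le_{\mathrm{cont},\mathrm{fq}}\mathcal P=(\Xi,\Omega,(\mathcal M,d),\Lambda_{\mathcal P})$ if there are continuous maps $E:\Sigma\to\Omega$ (initial evaluation topologies) and $D:\mathcal M\to\mathcal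 N$ and, for every $f\in\Lambda_{\mathcal P}$, some $m_f\in\mathbb N_0$, evaluations $\gamma_{f,1},\dots,\gamma_{f,m_f}\in\Lambda_{\mathcal S}$, and a continuous map $\vartheta_f$ from the joint image $\{(\gamma_{f,1}(A),\dots,\gamma_{f,m_f}(A)):A\in\Sigma\}\subseteq\mathbb C^{m_f}$ (subspace topology; one point if $m_f=0$) to $\mathbb C$, such that for all $A\in\Sigma$: $D(\Xi(E(A)))=\Psi(A)$ and $f(E(A))=\vartheta_f(\gamma_{f,1}(A),\dots,\gamma_{f,m_f}(A))$ for all $f\in\Lambda_{\mathcal P}$. Diagonal operators: $\Omega_{\mathrm{diag}}$ is the class of maximal closed diagonal operators on $\ell^2(\mathbb N)$: for a sequence $(a_j)_{j\in\mathbb N}\subset\mathbb C$, $\mathcal D(A)=\{x\in\ell^2(\mathbb N):(a_jx_j)_j\in\ell^2(\mathbb N)\}$, $(Ax)_j=a_jx_j$. Singleton windows: $\mathcal K_{\mathrm{sgl}}(J)=\{\{z\}:z\in J\}$; for each $K=\{z\}$ approximants $r_n(K)\in\mathbb Q+i\mathbb Q$, $n\in\mathbb N$, with $|r_n(K)-z|\le2^{-(n+1)}$ are fixed. Interface: $\Lambda_{\mathrm{diag}}=\{\mu_j:j\in\mathbb N\}\cup\{\rho_n:n\in\mathbb N\}$, $\mu_j(A,K)=a_j$ (where $Ae_j=a_je_j$), $\rho_n(A,K)=r_n(K)$. Pseudospectrum: $\sigma_\varepsilon(A)=\overline{\{z\in\mathbb C:\|(A-zI)^{-1}\|>\varepsilon^{-1}\}}$,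 with norm $=\infty$ on $\sigma(A)$. Problems: $\mathcal P^{\sigma}_{J,\mathrm{diag}}$ has instance set $\Omega_{\mathrm{diag}}\times\mathcal K_{\mathrm{sgl}}(J)$, interface $\Lambda_{\mathrm{diag}}$, output space $\{0,1\}$ with the discrete metric and target $1$ if $\sigma(A)\cap K=\varnothing$, $0$ otherwise; $\mathcal P^{\sigma_\varepsilon}_{J,\varepsilon,\mathrm{diag}}$ is the same with target $1$ if $\sigma_\varepsilon(A)\cap K=\varnothing$, $0$ otherwise. *)

(* Defs.v *)
From HB Require Import structures.
From mathcomp Require Import all_boot all_order all_algebra.
From mathcomp Require Import all_classical all_reals all_analysis.
From mathcomp Require Import complex ring.

Set Implicit Arguments.
Unset Strict Implicit.
Unset Printing Implicit Defensive.

Import Order.TTheory GRing.Theory Num.Theory.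
Import numFieldNormedType.Exports.
Import Normc.

Local Open Scope classical_set_scope.
Local Open Scope ring_scope.
Local Open Scope complex_scope.

(* The library equips a numFieldType K with its norm topology only through K^o
   or through generic instances that do not fire on R[i]. *)
HB.instance Definition _ (R : realType) := NormedModule.copy R[i] (R[i]^o).

Record problem (R : realType) := Problem {
  instances : choiceType;
  output : metricType R;
  target : instances -> output;
  interface : set (instances -> R[i]);
  interface_separates : forall A B, target A <> target B ->
    exists2 f, interface f & f A <> f B }.
Arguments interface {R} p _.

Definition evaluation_space (R : realType) (P : problem R) : topologicalType :=
  sup_topology (fun f : interface P =>
    Topological.class (initial_topology (\val f : instances P -> R[i]))).

(* vartheta is a total function on C^m, but only its restriction to the joint
   image of the gamma_i is constrained. *)
Definition cont_fq_le (R : realType) (S P : problem R) : Prop :=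
  exists (E : evaluation_space S -> evaluation_space P)
         (D : output P -> output S),
    [/\ continuous E, continuous D,
        forall A, D (target (E A : instances P)) = target (A : instances S) &
        forall f, interface P f ->
          exists (m : nat) (gamma : 'I_m -> instances S -> R[i])
                 (vartheta : 'rV[R[i]]_m -> R[i]),
            [/\ forall i, interface S (gamma i),
                {within range (fun A => \row_i gamma i A), continuous vartheta} &
                forall A, f (E A) = vartheta (\row_i gamma i A)]].

Definition cont_fq_equiv (R : realType) (S P : problem R) : Prop :=
  cont_fq_le S P /\ cont_fq_le P S.

(* Sequences are indexed by nat, hence from 0: x j stands for x_(j+1). *)
Section l2.
Variable R : realType.
Implicit Types x y : nat -> R[i].

Definition square_summable x : Prop :=
  cvgn (series (fun j => normc (x j) ^+ 2)).

Definition l2_pred : {pred nat -> R[i]} := fun x => `[< square_summable x >].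

Lemma l2_predP x : reflect (square_summable x) (x \in l2_pred).
Proof. exact: asboolP. Qed.

Lemma square_summable_le x (b : nat -> R) :
  (forall j, normc (x j) ^+ 2 <= b j) -> cvgn (series b) -> square_summable x.
Proof.
move=> xb; apply: series_le_cvg => // n; first exact: sqr_ge0.
by apply: le_trans (xb n); exact: sqr_ge0.
Qed.

Lemma square_summable_finite x (n : nat) :
  (forall j, (n <= j)%N -> x j = 0) -> square_summable x.
Proof.
move=> x0; rewrite /square_summable -(is_cvg_series_restrict n).
rewrite (_ : [sequence _]_n = cst 0); first exact: is_cvg_cst.
apply/funext => m /=; rewrite big_nat big1// => j /andP[nj _].
by rewrite x0// normc0 expr0n.
Qed.

Lemma l2_pred_submod : submod_closed l2_pred.
Proof.
split=> [|c x y /l2_predP sx /l2_predP sy]; apply/l2_predP.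
  exact: (@square_summable_finite _ 0).
pose b := ((2 * normc c ^+ 2) *: (fun j => normc (x j) ^+ 2)) +
          ((2 : R) *: (fun j => normc (y j) ^+ 2)).
apply: (@square_summable_le _ b) => [j|]; last first.
  by apply: is_cvg_seriesD; exact: is_cvg_seriesZ.
have -> : b j = 2 * ((normc c * normc (x j)) ^+ 2) + 2 * normc (y j) ^+ 2.
  by rewrite exprMn mulrA.
rewrite -normcM -[(c *: x + y) j]/(c * x j + y j).
have := le_normcD (c * x j) (y j).
set u := normc (c * x j); set v := normc (y j); set w := normc _ => wuv.
have w0 : 0 <= w by rewrite /w; case: (c * x j + y j) => p q; exact: sqrtr_ge0.
apply: (@le_trans _ _ ((u + v) ^+ 2)).
  by rewrite lerXn2r// ?nnegrE// (le_trans w0 wuv).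
rewrite -subr_ge0 (_ : _ - _ = (u - v) ^+ 2) ?sqr_ge0//.
ring.
Qed.

HB.instance Definition _ :=
  GRing.isSubmodClosed.Build R[i] (nat -> R[i]) l2_pred l2_pred_submod.

Record l2 := L2 { l2_seq :> nat -> R[i]; l2_seqP : l2_seq \in l2_pred }.

HB.instance Definition _ := [isSub for l2_seq].
HB.instance Definition _ := [Choice of l2 by <:].
HB.instance Definition _ := [SubChoice_isSubLmodule of l2 by <:].

Definition l2norm (x : l2) : R :=
  Num.sqrt (limn (series (fun j => normc (x j) ^+ 2))).

Lemma unit_seq_in_l2 (j : nat) :
  (fun k : nat => (k == j)%:R : R[i]) \in l2_pred.
Proof.
apply/l2_predP; apply: (@square_summable_finite _ j.+1) => k jk.
by rewrite gtn_eqF.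
Qed.

Definition unit_vector (j : nat) : l2 := L2 (unit_seq_in_l2 j).

End l2.

Section operators.
Variable R : realType.

(* The action is a function on the domain seen as a type, so that an operator
   carries no information outside of its domain. *)
Record operator := Operator {
  dom : set (l2 R);
  app : dom -> l2 R;
  dom_linear : dom 0 /\
    forall (c : R[i]) x y, dom x -> dom y -> dom (c *: x + y);
  app_linear : forall (c : R[i]) (x y w : dom),
    \val w = c *: \val x + \val y -> app w = c *: app x + app y }.

HB.instance Definition _ := gen_eqMixin operator.
HB.instance Definition _ := gen_choiceMixin operator.

Section shift.
Variables (A : operator) (z : R[i]).

Definition shift_app (x : dom A) : l2 R := app x - z *: \val x.

Lemma shift_linear (c : R[i]) (x y w : dom A) :
  \val w = c *: \val x + \val y -> shift_app w = c *: shift_app x + shift_app y.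
Proof.
move=> wE; rewrite /shift_app (app_linear wE) wE.
by rewrite scalerDr scalerBr !scalerA (mulrC z c) opprD addrACA.
Qed.

(* A - z I *)
Definition shift : operator := Operator (dom_linear A) shift_linear.

End shift.

Definition inverse_of (T : operator) (B : l2 R -> l2 R) : Prop :=
  (forall y, exists2 x : dom T, \val x = B y & app x = y) /\
  (forall x : dom T, B (app x) = \val x).

Definition bounded_map (B : l2 R -> l2 R) : Prop :=
  exists M : R, forall y, l2norm (B y) <= M * l2norm y.

Definition spectrum (A : operator) : set R[i] :=
  ~` [set z | exists2 B, inverse_of (shift A z) B & bounded_map B].

Definition operator_norm (B : l2 R -> l2 R) : \bar R :=
  ereal_sup [set (l2norm (B y))%:E | y in [set y | l2norm y <= 1]].

(* meaningful for z outside of the spectrum only *)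
Definition resolvent (A : operator) (z : R[i]) : l2 R -> l2 R :=
  xget (fun=> 0) [set B | inverse_of (shift A z) B].

Definition resolvent_norm (A : operator) (z : R[i]) : \bar R :=
  if z \in spectrum A then +oo%E else operator_norm (resolvent A z).

Definition pseudospectrum (eps : R) (A : operator) : set R[i] :=
  closure [set z | (eps^-1%:E < resolvent_norm A z)%E].

End operators.

Section diagonal.
Variable R : realType.
Variable a : nat -> R[i].

Definition diag_seq (x : nat -> R[i]) : nat -> R[i] := fun j => a j * x j.

Definition diag_dom : set (l2 R) := [set x | diag_seq x \in @l2_pred R].

Definition diag_app (x : diag_dom) : l2 R := L2 (set_valP x).

Lemma diag_dom_linear : diag_dom 0 /\
  forall (c : R[i]) x y, diag_dom x -> diag_dom y -> diag_dom (c *: x + y).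
Proof.
split=> [|c x y dx dy]; rewrite /diag_dom /=.
  rewrite (_ : diag_seq _ = 0) ?rpred0//.
  by apply/funext => j; rewrite /diag_seq mulr0.
rewrite (_ : diag_seq _ = c *: diag_seq x + diag_seq y).
  by rewrite rpredD// rpredZ.
apply/funext => j; rewrite /diag_seq.
by rewrite -[RHS]/(c * (a j * x j) + a j * y j) mulrCA -mulrDr.
Qed.

Lemma diag_app_linear (c : R[i]) (x y w : diag_dom) :
  \val w = c *: \val x + \val y -> diag_app w = c *: diag_app x + diag_app y.
Proof.
move=> wE; apply/val_inj/funext => j /=.
rewrite -[LHS]/(a j * \val w j) wE.
rewrite -[RHS]/(c * (a j * \val x j) + a j * \val y j).
by rewrite -[X in a j * X]/(c * \val x j + \val y j) mulrCA -mulrDr.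
Qed.

Definition diag_op : operator R := Operator diag_dom_linear diag_app_linear.

End diagonal.

Definition Omega_diag (R : realType) : set (operator R) := range (@diag_op R).
Arguments Omega_diag R _ : clear implicits.

(* the scalar a_j such that A e_j = a_j e_j *)
Definition diag_coef (R : realType) (j : nat) (A : operator R) : R[i] :=
  xget 0 [set c | exists2 x : dom A,
    \val x = unit_vector R j & app x = c *: unit_vector R j].

Lemma diag_coefE (R : realType) (j : nat) (a : nat -> R[i]) :
  diag_coef j (diag_op a) = a j.
Proof.
have e_dom : diag_dom a (unit_vector R j).
  apply/l2_predP; apply: (@square_summable_finite _ _ j.+1) => k jk.
  by rewrite /diag_seq /= gtn_eqF// mulr0.
rewrite /diag_coef; case: xgetP => [c _ [x xE]|/(_ (a j)) no].
  move=> /(congr1 (fun v : l2 R => v j)).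
  rewrite -[LHS]/(a j * \val x j) xE -[RHS]/(c * (j == j)%:R) /=.
  by rewrite eqxx !mulr1.
exfalso; apply: no; exists (SigSub (mem_set e_dom)) => //.
apply/val_inj/funext => k /=.
rewrite -[RHS]/(a j * (k == j)%:R) /diag_seq /=.
by have [->|] := eqVneq k j; rewrite ?mulr0.
Qed.

Definition singleton_windows (R : realType) (J : set R) : set (set R[i]) :=
  [set [set z%:C] | z in J].

(* The index n runs over the positive integers; the value at n = 0 is junk that
   is neither constrained nor part of the interface. *)
Record approximants (R : realType) (J : set R) := Approximants {
  approx :> nat -> singleton_windows J -> R[i];
  approx_rational : forall n K, (0 < n)%N ->
    exists p q : rat, approx n K = ratr p +i* ratr q;
  approx_close : forall n (K : singleton_windows J) z, (0 < n)%N ->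
    \val K = [set z] -> `|approx n K - z| <= 2 ^- n.+1 }.

(* The output space {0, 1}, with true for 1. The alias separates the discrete
   metric below from the structures that bool already carries. *)
Definition decision (R : realType) : Type := bool.

Section decision.
Variable R : realType.

Definition decision_dist (b c : decision R) : R := (b != c :> bool)%:R.

Lemma decision_distxx b : decision_dist b b = 0.
Proof. by rewrite /decision_dist eqxx. Qed.

Lemma decision_dist_eq0 b c : decision_dist b c = 0 -> b = c.
Proof.
rewrite /decision_dist; case: eqP => //= _ /eqP.
by rewrite oner_eq0.
Qed.

Lemma decision_dist_sym b c : decision_dist b c = decision_dist c b.
Proof. by rewrite /decision_dist eq_sym. Qed.

Lemma decision_dist_triangle b a c :
  decision_dist a c <= decision_dist a b + decision_dist b c.
Proof.
by case: a b c => -[] [] /=; rewrite /decision_dist /= ?addr0 ?add0r ?ler01//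
  ?addr_ge0.
Qed.

HB.instance Definition _ := Choice.copy (decision R) bool.
HB.instance Definition _ := isMetric.Build R (decision R)
  decision_distxx decision_dist_eq0 decision_dist_sym decision_dist_triangle.

End decision.

Section diag_problems.
Variables (R : realType) (J : set R) (r : approximants J).

Definition diag_instances : choiceType :=
  (Omega_diag R * singleton_windows J)%type.

Definition mu (j : nat) (AK : diag_instances) : R[i] :=
  diag_coef j (\val AK.1).

Definition rho (n : nat) (AK : diag_instances) : R[i] := r n AK.2.

Definition Lambda_diag : set (diag_instances -> R[i]) :=
  range mu `|` [set rho n | n in [set n | (0 < n)%N]].

Lemma Lambda_diag_injective (AK BL : diag_instances) :
  (forall f, Lambda_diag f -> f AK = f BL) -> AK = BL.
Proof.
move: AK BL => [A K] [B L] eqf.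
have eqmu j : diag_coef j (\val A) = diag_coef j (\val B).
  by apply: (eqf (mu j)); left; exists j.
have eqrho n : (0 < n)%N -> r n K = r n L.
  by move=> n0; apply: (eqf (rho n)); right; exists n.
congr pair; apply/val_inj.
  have [a _ aA] := set_valP A; have [b _ bB] := set_valP B.
  rewrite -[LHS]aA -[RHS]bB; congr diag_op; apply/funext => j.
  by rewrite -(diag_coefE j a) -(diag_coefE j b) aA bB; exact: eqmu.
have [x _ xK] := set_valP K; have [y _ yL] := set_valP L.
rewrite -[LHS]xK -[RHS]yL; suff -> : x = y by [].
apply/eqP/negPn/negP => xy.
have d0 : 0 < `|x - y| by rewrite normr_gt0 subr_eq0.
have [n n0 nd] : exists2 n, (0 < n)%N & 1 / 2 ^+ n < `|x - y|.
  have [N _ HN] := near_infty_natSinv_expn_lt (PosNum d0).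
  by exists N.+1 => //; apply: HN => /=.
have hx := approx_close r n0 (esym xK).
have hy := approx_close r n0 (esym yL).
rewrite eqrho// in hx.
have : `|x%:C - y%:C| <= 2 ^- n :> R[i].
  have -> : 2 ^- n = 2 ^- n.+1 + 2 ^- n.+1 :> R[i].
    by rewrite exprSr invfM -splitr.
  rewrite (le_trans (ler_distD (r n L) _ _))// lerD//.
  by rewrite distrC.
rewrite -rmorphB /= normc_def /= expr0n/= addr0 sqrtr_sqr => h.
have : (`|x - y|)%:C <= (1 / 2 ^+ n)%:C.
  by rewrite div1r fmorphV rmorphXn /= rmorph_nat.
by rewrite lecR leNgt nd.
Qed.

Definition disjointness (S : operator R -> set R[i]) (AK : diag_instances) :
  decision R := `[< S (\val AK.1) `&` \val AK.2 = set0 >].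

Lemma Lambda_diag_separates (S : operator R -> set R[i]) (AK BL : diag_instances) :
  disjointness S AK <> disjointness S BL ->
  exists2 f, Lambda_diag f & f AK <> f BL.
Proof.
move=> neq; apply: contrapT => noex; apply: neq; congr disjointness.
apply: Lambda_diag_injective => f Lf; apply: contrapT => neqf.
by apply: noex; exists f.
Qed.

Definition diag_problem (S : operator R -> set R[i]) : problem R :=
  Problem (@Lambda_diag_separates S).

Definition spectrum_problem : problem R := diag_problem (@spectrum R).

Definition pseudospectrum_problem (eps : R) : problem R :=
  diag_problem (pseudospectrum eps).

End diag_problems.

(* Main.v *)
Require Import Defs.
From mathcomp Require Import all_boot all_order all_algebra.
From mathcomp Require Import all_classical all_reals all_analysis.
From mathcomp Require Import complex ring lra.
Import Order.TTheory GRing.Theory Num.Theory.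
Import numFieldNormedType.Exports.
Import Normc.
Local Open Scope classical_set_scope.
Local Open Scope ring_scope.

Set Implicit Arguments.
Unset Strict Implicit.

(** Both problems only see the sequence [a] of diagonal entries.  A number [z]
lies in the resolvent set of the diagonal operator exactly when the distances
[|a_j - z|] are bounded away from [0] (the inverse is the diagonal operator with
entries [1 / (a_j - z)], and unit vectors show that it cannot be bounded
otherwise), and the norm of the resolvent is the supremum of the [1 / |a_j - z|].
Hence the spectrum is the closure of the set of entries ([spectrum_diag]) and the
pseudospectrum is the set of points at distance at most [eps] from the entries
([pseudospectrum_diag], [pseudospectrum_diagP]).

Each reduction keeps the window and builds a new diagonal operator whose [n]-th
entry is a continuous function of one entry of the old one.  Such a map is
continuous for the evaluation topologies and costs one query per evaluation, and
the identity of [{0, 1}] is a decoder as soon as the two spectral sets have the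
same real points in [J] ([coefficientwise_cont_fq_le]).  Two choices of entries
finish the proof.

- From the pseudospectrum to the spectrum, the new entries are all the sums
  [a_j + q] with [q] in a countable dense subset of the open disk of radius [eps]
  around [0]: they are dense in the open [eps]-neighbourhood of the old entries,
  so the spectrum of the new operator is the pseudospectrum of the old one.

- From the spectrum to the pseudospectrum, the entry [x + i y] is replaced by
  [x + i (eps + |y|)].  For [t] real,
  [|x + i (eps + |y|) - t|^2 = |x + i y - t|^2 + 2 eps |y| + eps^2], which comes
  close to [eps^2] exactly when [x + i y] comes close to [t].  This is where it
  matters that windows lie on the real line: the closed [eps]-disk around
  [x + i eps] touches it at [x] alone. *)

(** * The modulus metric on the complex numbers *)

Section modulus.
Variable R : realType.
Implicit Types (x y z w : R[i]) (S : set R[i]) (e : R).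

Lemma normc_ge0 z : 0 <= normc z.
Proof. by case: z => p q; exact: sqrtr_ge0. Qed.

Lemma normc_distC x y : normc (x - y) = normc (y - x).
Proof. by rewrite -[RHS]normcN opprB. Qed.

Lemma normc_distD y x z : normc (x - z) <= normc (x - y) + normc (y - z).
Proof. by rewrite (le_trans _ (le_normcD _ _))// addrA subrK. Qed.

Lemma normc_real e : 0 <= e -> normc (e%:C)%C = e.
Proof. by move=> e0; rewrite /normc/= expr0n addr0 sqrtr_sqr ger0_norm. Qed.

Lemma sqr_normc_complex (p q : R) : normc (p +i* q)%C ^+ 2 = p ^+ 2 + q ^+ 2.
Proof. by rewrite /normc sqr_sqrtr// addr_ge0// sqr_ge0. Qed.

Lemma ler_sqr_normc x y : normc x ^+ 2 <= normc y ^+ 2 -> normc x <= normc y.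
Proof. by rewrite ler_sqr ?nnegrE ?normc_ge0. Qed.

Lemma normc_rect_le (p q : R) : normc (p +i* q)%C <= `|p| + `|q|.
Proof.
rewrite -ler_sqr ?nnegrE ?normc_ge0 ?addr_ge0// sqr_normc_complex.
by rewrite sqrrD !real_normK ?num_real// addrAC lerDl mulrn_wge0// mulr_ge0.
Qed.

(** The balls of [R[i]] have their radii in [R[i]]; this is the passage to real
radii. *)
Lemma closure_normcP S z :
  closure S z <-> forall e, 0 < e -> exists2 w, S w & normc (z - w) < e.
Proof.
split=> [Sz e e0|Sz B /nbhs_ballP[d /= d0 dB]].
  have e0' : 0 < (e%:C)%C :> R[i] by rewrite ltcR.
  have [w [Sw zw]] := Sz _ (nbhsx_ballx z _ e0').
  by exists w => //; rewrite -ltcR.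
have dE : d = ((complex.Re d)%:C)%C by rewrite RRe_real// gtr0_real.
have [|w Sw zw] := Sz (complex.Re d); first by rewrite -ltcR -dE.
exists w; split => //; apply: dB; rewrite dE.
by rewrite -ltcR in zw.
Qed.

Lemma nonexpansive_continuous (g : R[i] -> R[i]) :
  (forall x y, normc (g x - g y) <= normc (x - y)) -> continuous g.
Proof.
move=> g1 x U /nbhs_ballP[e /= e0 eU]; apply/nbhs_ballP; exists e => //= y xy.
apply: eU; apply: le_lt_trans xy.
by rewrite -[leLHS]/((normc (g x - g y))%:C)%C lecR.
Qed.

Lemma rational_complex_dense z e : 0 < e ->
  exists p q : rat, normc (z - (ratr p +i* ratr q)%C) < e.
Proof.
case: z => x y e0; have lt_itv (t : R) : t - e / 2 < t + e / 2 by lra.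
have [p /itvP hp] := rat_in_itvoo (lt_itv x).
have [q /itvP hq] := rat_in_itvoo (lt_itv y).
exists p, q; rewrite (le_lt_trans (normc_rect_le _ _))// [ltRHS]splitr.
by rewrite ltrD// ltr_distlC ?hp ?hq.
Qed.

End modulus.

(** * Estimates for the norm of square-summable sequences *)

Section l2norm.
Variable R : realType.
Implicit Types (x y : l2 R) (c : R).

Lemma normc_le_l2norm y j : normc (y j) <= l2norm y.
Proof.
have /l2_predP sy := l2_seqP y.
rewrite -(ger0_norm (normc_ge0 (y j))) -sqrtr_sqr; apply: ler_wsqrtr.
have nd : nondecreasing_seq (series (fun k => normc (y k) ^+ 2)).
  by apply/nondecreasing_series => k _ _; exact: sqr_ge0.
apply: le_trans (nondecreasing_cvgn_le nd sy j.+1).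
by rewrite /series/= big_nat_recr//= lerDr sumr_ge0// => k _; exact: sqr_ge0.
Qed.

Lemma l2norm_le x y c : 0 <= c ->
  (forall j, normc (x j) <= c * normc (y j)) -> l2norm x <= c * l2norm y.
Proof.
move=> c0 xy; have /l2_predP sx := l2_seqP x; have /l2_predP sy := l2_seqP y.
rewrite -[X in X * _](ger0_norm c0) -sqrtr_sqr /l2norm -sqrtrM ?sqr_ge0//.
apply: ler_wsqrtr.
rewrite -[leRHS](lim_seriesZ (c ^+ 2) sy).
apply: lim_series_le => //; first exact: is_cvg_seriesZ.
move=> j /=; rewrite -[leRHS]exprMn.
by rewrite ler_sqr ?nnegrE ?mulr_ge0 ?normc_ge0.
Qed.

Lemma l2norm_unit_vector j : l2norm (unit_vector R j) <= 1.
Proof.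
have /l2_predP sj := l2_seqP (unit_vector R j).
rewrite -sqrtr1; apply: ler_wsqrtr; apply: limr_le => //.
apply: nearW => n.
suff -> : series (fun k => normc (unit_vector R j k) ^+ 2) n = (j < n)%:R.
  by rewrite lern1 leq_b1.
elim: n => [|n IHn]; first by rewrite /series/= big_geq.
rewrite seriesSr IHn /= ltnS [in RHS]leq_eqVlt eq_sym.
have [->|] := eqVneq n j; first by rewrite ltnn normc1 expr1n add0r.
by rewrite normc0 expr0n addr0.
Qed.

End l2norm.

(** * Spectrum and pseudospectrum of a diagonal operator *)

Section diagonal_spectrum.
Variable R : realType.
Variables (a : nat -> R[i]).
Implicit Types (z : R[i]) (c eps : R) (B : l2 R -> l2 R).

(** Every inverse of [A - z I] divides coordinatewise by [a_j - z]; the estimates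
below therefore apply to any inverse, in particular to the one that the resolvent
selects. *)
Lemma inverse_diagE z B : inverse_of (Defs.shift (diag_op a) z) B ->
  forall y j, (a j - z) * B y j = y j.
Proof.
move=> [invB _] y j; have [x xE yE] := invB y.
by rewrite -[in RHS]yE -xE mulrBl.
Qed.

Lemma inverse_diag_exists z c : 0 < c ->
  (forall j, c <= normc (a j - z)) ->
  exists B, inverse_of (Defs.shift (diag_op a) z) B.
Proof.
move=> c0 cz.
have az0 j : a j - z != 0.
  by apply/eqP => az; have := cz j; rewrite az normc0 leNgt c0.
have Bl2 (y : l2 R) : (fun j => (a j - z)^-1 * y j) \in @l2_pred R.
  have /l2_predP sy := l2_seqP y; apply/l2_predP.
  apply: (@square_summable_le _ _ ((c^-1 ^+ 2) *: (fun j => normc (y j) ^+ 2))).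
    move=> j; rewrite -[leRHS]/(c^-1 ^+ 2 * normc (y j) ^+ 2).
    rewrite normcM exprMn ler_wpM2r ?sqr_ge0// normcV.
    rewrite ler_sqr ?nnegrE ?invr_ge0 ?normc_ge0 ?(ltW c0)//.
    by rewrite lef_pV2 ?posrE// (lt_le_trans c0).
  exact: is_cvg_seriesZ.
pose B y := L2 (Bl2 y).
(* [a_j / (a_j - z) * y_j = y_j + z * (y_j / (a_j - z))] is square-summable *)
have domB y : diag_dom a (B y).
  rewrite /diag_dom /=.
  have -> : diag_seq a (B y) = \val (y + z *: B y).
    apply/funext => j; rewrite /diag_seq.
    rewrite -[RHS]/(y j + z * B y j) -[in RHS](mulVKf (az0 j) (y j)).
    by rewrite -[B y j]/((a j - z)^-1 * y j) -mulrDl subrK.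
  exact: l2_seqP.
exists B; split=> [y|x].
  exists (SigSub (mem_set (domB y))) => //; apply/val_inj/funext => j.
  rewrite -[LHS]/(a j * ((a j - z)^-1 * y j) - z * ((a j - z)^-1 * y j)).
  by rewrite -mulrBl mulVKf.
apply/val_inj/funext => j.
rewrite -[LHS]/((a j - z)^-1 * (a j * \val x j - z * \val x j)).
by rewrite -mulrBl mulKf.
Qed.

Lemma inverse_diag_le z B c : inverse_of (Defs.shift (diag_op a) z) B -> 0 < c ->
  (forall j, c <= normc (a j - z)) -> forall y, l2norm (B y) <= c^-1 * l2norm y.
Proof.
move=> invB c0 cz y; apply: l2norm_le => [|j]; first by rewrite invr_ge0 ltW.
rewrite -(inverse_diagE invB y j) normcM mulrA ler_peMl ?normc_ge0//.
by rewrite mulrC ler_pdivlMr// mul1r.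
Qed.

(** An inverse maps the unit vector [e_j] to [e_j / (a_j - z)]. *)
Lemma inverse_diag_ge z B j : inverse_of (Defs.shift (diag_op a) z) B ->
  0 < normc (a j - z) /\ (normc (a j - z))^-1 <= l2norm (B (unit_vector R j)).
Proof.
move=> invB; have := inverse_diagE invB (unit_vector R j) j.
rewrite /= eqxx => /(congr1 (@normc R)); rewrite normcM normc1 => E.
have az0 : normc (a j - z) != 0.
  by apply/eqP => az; move: E; rewrite az mul0r => /esym/eqP; rewrite oner_eq0.
split; first by rewrite lt_neqAle eq_sym az0 normc_ge0.
apply: le_trans (normc_le_l2norm _ j).
by rewrite -[leLHS]mulr1 -E mulKf.
Qed.

Lemma notin_spectrum_diagP z : ~ spectrum (diag_op a) z <->
  exists2 c, 0 < c & forall j, c <= normc (a j - z).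
Proof.
rewrite /spectrum /setC /= notK; split=> [[B invB [M boundM]]|[c c0 cz]].
  have inv_le j : (normc (a j - z))^-1 <= `|M|.
    have [_ /le_trans->//] := inverse_diag_ge j invB.
    rewrite (le_trans (boundM _))//.
    have le1 := @l2norm_unit_vector R j.
    rewrite (le_trans (ler_norm _))// normrM -[leRHS]mulr1 ler_wpM2l//.
    by rewrite ger0_norm// sqrtr_ge0.
  exists (1 + `|M|)^-1 => [|j]; first by rewrite invr_gt0 ltr_pwDl.
  have [az0 _] := inverse_diag_ge j invB.
  rewrite -[leRHS]invrK lef_pV2 ?posrE ?invr_gt0 ?ltr_pwDl//.
  by rewrite (le_trans (inv_le j))// lerDr.
have [B invB] := inverse_diag_exists c0 cz.
by exists B => //; exists c^-1; exact: (inverse_diag_le invB c0 cz).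
Qed.

Lemma spectrum_diag : spectrum (diag_op a) = closure (range a).
Proof.
apply/seteqP; split=> z.
  move=> sz; apply/closure_normcP => e e0; apply: contrapT => far.
  apply: (notin_spectrum_diagP z).2 sz; exists e => // j.
  rewrite leNgt; apply/negP => near; apply: far; exists (a j); first by exists j.
  by rewrite normc_distC.
move=> /closure_normcP cz; apply: contrapT => /notin_spectrum_diagP[c c0 far].
have [_ [j _ <-]] := cz c c0.
by rewrite normc_distC ltNge far.
Qed.

(** The norm of the resolvent is the supremum of the [1 / |a_j - z|].  If some
[|a_j - z|] is less than [eps], the unit vector [e_j] witnesses the strict
inequality; if none is, the norm is at most [1 / eps].  On the spectrum, where
the norm is infinite, entries come arbitrarily close to [z]. *)
Lemma resolvent_norm_diag eps z : 0 < eps ->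
  (eps^-1%:E < resolvent_norm (diag_op a) z)%E <->
  exists j, normc (a j - z) < eps.
Proof.
move=> eps0; rewrite /resolvent_norm; case: ifPn => [|nz].
  rewrite inE spectrum_diag => /closure_normcP/(_ _ eps0)[_ [j _ <-] zj].
  by split=> _; [exists j; rewrite normc_distC|exact: ltry].
have /notin_spectrum_diagP[c c0 cz] : ~ spectrum (diag_op a) z.
  by move=> sz; rewrite mem_set in nz.
have invB : inverse_of (Defs.shift (diag_op a) z) (resolvent (diag_op a) z).
  by have [B invB] := inverse_diag_exists c0 cz; exact: (xgetPex _ (ex_intro _ _ invB)).
split=> [|[j zj]].
  apply: contraPP => /forallNP far; apply/negP; rewrite -leNgt.
  apply: ge_ereal_sup => _ [y /= y1 <-]; rewrite lee_fin.
  have eps_le j : eps <= normc (a j - z) by rewrite leNgt; apply/negP/far.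
  rewrite (le_trans (inverse_diag_le invB eps0 eps_le y))//.
  by rewrite ler_piMr// invr_ge0 ltW.
have [az0 ge] := inverse_diag_ge j invB.
apply: (@lt_le_trans _ _ (l2norm (resolvent (diag_op a) z (unit_vector R j)))%:E).
  by rewrite lte_fin (lt_le_trans _ ge)// ltf_pV2.
by apply: ereal_sup_ubound; exists (unit_vector R j) => //=; exact: l2norm_unit_vector.
Qed.

Lemma pseudospectrum_diag eps : 0 < eps ->
  pseudospectrum eps (diag_op a) =
  closure [set z | exists j, normc (a j - z) < eps].
Proof.
move=> eps0; congr closure; apply/funext => z.
by apply/propext; exact: resolvent_norm_diag.
Qed.

(** The closure of the open [eps]-neighbourhood of a set is its closed
[eps]-neighbourhood, because a point slightly farther than [eps] from [a_j] can be
moved towards [a_j]. *)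
Lemma pseudospectrum_diagP eps z : 0 < eps ->
  pseudospectrum eps (diag_op a) z <->
  forall d, 0 < d -> exists j, normc (a j - z) < eps + d.
Proof.
move=> eps0; rewrite pseudospectrum_diag//; split=> [/closure_normcP cz d d0|near].
  have [w [j jw] zw] := cz d d0; exists j.
  by rewrite (le_lt_trans (normc_distD w _ _))// ltrD// normc_distC.
apply/closure_normcP => d d0; have [j zj] := near d d0.
have ed0 : 0 < eps + d by rewrite addr_gt0.
(* w divides the segment from z to a j in the ratio d : eps *)
pose w := z + ((d / (eps + d))%:C)%C * (a j - z).
exists w; [exists j|].
  have -> : a j - w = ((eps / (eps + d))%:C)%C * (a j - z).
    have -> : eps / (eps + d) = 1 - d / (eps + d) by field; exact: lt0r_neq0.
    by rewrite rmorphB rmorph1 /w; ring.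
  rewrite normcM normc_real ?divr_ge0 ?(ltW eps0) ?(ltW ed0)//.
  by rewrite mulrAC ltr_pdivrMr// ltr_pM2l.
rewrite normc_distC /w addrC addKr normcM normc_real; last by rewrite divr_ge0 ?ltW.
by rewrite mulrAC ltr_pdivrMr// ltr_pM2l.
Qed.

End diagonal_spectrum.

(** * Evaluation topologies and coefficientwise transports *)

Lemma setI1_eq0 (V : Type) (X : set V) v : (X `&` [set v] = set0) = ~ X v.
Proof.
apply/propext; split=> [/disjoints_subset XvC Xv|nXv].
  exact: (XvC v Xv).
by apply/disjoints_subset => u Xu /= uv; apply: nXv; rewrite -uv.
Qed.

Lemma interface_continuous (R : realType) (P : problem R) f :
  Defs.interface P f -> continuous (f : evaluation_space P -> R[i]).
Proof.
move=> Pf A; pose i : Defs.interface P := SigSub (mem_set Pf).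
have /cvg_sup/(_ i) to_i :
    nbhs (A : evaluation_space P) --> (A : evaluation_space P) by exact: cvg_id.
move=> U /(@initial_continuous _ _ (\val i : instances P -> R[i]) A) fU.
exact: to_i.
Qed.

Lemma continuous_to_evaluation_space (R : realType) (X : topologicalType)
    (P : problem R) (E : X -> evaluation_space P) :
  (forall f, Defs.interface P f -> continuous (f \o E : X -> R[i])) -> continuous E.
Proof.
move=> fE A; apply/cvg_sup => i.
apply: (@continuous_comp_initial _ _ _ (\val i : instances P -> R[i]) E).
by apply: fE; exact: (set_valP i).
Qed.

(** The transports considered here leave the window alone and replace the
sequence [a] by [n |-> phi n (a (s n))].  Windows are single points of [J], so
the answers agree as soon as the spectral sets agree there. *)
Section coefficientwise_transport.
Variables (R : realType) (J : set R) (r : approximants J).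
Variables (S T : operator R -> set R[i]).
Variables (phi : nat -> R[i] -> R[i]) (s : nat -> nat).
Hypothesis phi_continuous : forall n, continuous (phi n).
Hypothesis phi_reduces : forall (a : nat -> R[i]) (t : R), J t ->
  S (diag_op a) (t%:C)%C <-> T (diag_op (fun n => phi n (a (s n)))) (t%:C)%C.

Definition transport_op (A : Omega_diag R) : Omega_diag R :=
  SigSub (mem_set (imageT (@diag_op R) (fun n => phi n (diag_coef (s n) (\val A))))).

Definition transport (AK : diag_instances J) : diag_instances J :=
  (transport_op AK.1, AK.2).

Lemma mu_transport n AK : mu n (transport AK) = phi n (mu (s n) AK).
Proof. exact: diag_coefE. Qed.

Lemma disjointness_transport AK :
  disjointness T (transport AK) = disjointness S AK.
Proof.
case: AK => A K; rewrite /disjointness /=; congr asbool.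
have [a _ aA] := set_valP A; have [t Jt tK] := set_valP K.
have -> : (fun n => phi n (diag_coef (s n) (\val A))) = (fun n => phi n (a (s n))).
  by apply/funext => n; rewrite -[\val A]aA diag_coefE.
rewrite -[\val A]aA -[\val K]tK !setI1_eq0; apply/propext.
by split=> nST /(phi_reduces a Jt).
Qed.

Lemma coefficientwise_cont_fq_le :
  cont_fq_le (diag_problem r S) (diag_problem r T).
Proof.
(* every evaluation of the image is a continuous function of one evaluation *)
have query f : Lambda_diag r f -> exists2 g, Lambda_diag r g &
    exists2 v : R[i] -> R[i], continuous v & forall AK, f (transport AK) = v (g AK).
  move=> [[n _ <-]|[n n0 <-]].
    exists (mu (s n)); first by left; exists (s n).
    by exists (phi n) => // AK; exact: mu_transport.
  by exists (rho r n); [right; exists n|exists idfun => // x; exact: cvg_id].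
exists transport, idfun; split.
- apply: continuous_to_evaluation_space => f /query[g Lg [v cv fE]].
  rewrite (_ : f \o transport = v \o g); last exact/funext.
  by move=> AK; apply: continuous_comp (cv _); exact: interface_continuous.
- by move=> x; exact: cvg_id.
- exact: disjointness_transport.
- move=> f /query[g Lg [v cv fE]].
  exists 1, (fun=> g), (fun w => v (w 0 0)); split => [//||AK].
    apply: continuous_subspaceT => w.
    by apply: continuous_comp (cv _); exact: coord_continuous.
  by rewrite mxE fE.
Qed.

End coefficientwise_transport.

(** * The two reductions *)

(** Lifting the entries into the half-plane [Im >= eps] makes the
[eps]-disks around them meet the real line only near the real entries. *)
Lemma spectrum_le_pseudospectrum (R : realType) (J : set R) (r : approximants J)
    (eps : R) : 0 < eps ->
  cont_fq_le (spectrum_problem r) (pseudospectrum_problem r eps).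
Proof.
move=> eps0.
pose lift (w : R[i]) : R[i] := let: (x +i* y)%C := w in (x +i* (eps + `|y|))%C.
apply: (@coefficientwise_cont_fq_le _ _ _ _ _ (fun=> lift) id) => [_|a t _].
  apply: nonexpansive_continuous => -[x y] [x' y']; apply: ler_sqr_normc.
  rewrite /lift /=; simpc; rewrite !sqr_normc_complex lerD2l addrACA subrr add0r.
  by rewrite -[leLHS]real_normK ?num_real// -[leRHS]real_normK ?num_real//
    lerXn2r ?nnegrE// ler_dist_dist.
have lift_dist (w : R[i]) : normc (lift w - (t%:C)%C) ^+ 2 =
    normc (w - (t%:C)%C) ^+ 2 + 2 * eps * `|complex.Im w| + eps ^+ 2.
  case: w => x y; rewrite /lift; simpc; rewrite !sqr_normc_complex.
  by rewrite -[y ^+ 2]real_normK ?num_real//; ring.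
rewrite spectrum_diag; split.
  move=> /closure_normcP near; apply/pseudospectrum_diagP => // d d0.
  have [_ [j _ <-] tj] := near d d0; exists j.
  rewrite -ltr_sqr ?nnegrE ?normc_ge0 ?addr_ge0 ?ltW// lift_dist.
  rewrite normc_distC in tj.
  have Im_le : `|complex.Im (a j)| <= normc (a j - (t%:C)%C).
    rewrite -ler_sqr ?nnegrE ?normc_ge0// real_normK ?num_real//.
    by case: (a j) => x y; simpc; rewrite sqr_normc_complex lerDr sqr_ge0.
  have := normc_ge0 (a j - (t%:C)%C); nra.
move=> /pseudospectrum_diagP near; apply/closure_normcP => d d0.
(* [h] is chosen so that [|lift w - t| < h] leaves [|w - t| < d] *)
pose h := Num.sqrt (eps ^+ 2 + d ^+ 2).
have h2 : h ^+ 2 = eps ^+ 2 + d ^+ 2 by rewrite sqr_sqrtr// addr_ge0// sqr_ge0.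
have h0 : eps < h.
  by rewrite -ltr_sqr ?nnegrE ?sqrtr_ge0 ?ltW// h2 ltrDl exprn_gt0.
have h_eps0 : 0 < h - eps by rewrite subr_gt0.
have [j] := near eps0 _ h_eps0.
rewrite subrKC -ltr_sqr ?nnegrE ?normc_ge0 ?sqrtr_ge0// lift_dist h2 => tj.
exists (a j); first by exists j.
rewrite normc_distC -ltr_sqr ?nnegrE ?normc_ge0 ?ltW//.
have : 0 <= 2 * eps * `|complex.Im (a j)| by rewrite mulr_ge0// mulr_ge0// ltW.
lra.
Qed.

(** Adding to every entry all points of a countable dense subset of the open
[eps]-disk turns the pseudospectrum into the spectrum. *)
Lemma pseudospectrum_le_spectrum (R : realType) (J : set R) (r : approximants J)
    (eps : R) : 0 < eps ->
  cont_fq_le (pseudospectrum_problem r eps) (spectrum_problem r).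
Proof.
move=> eps0.
(* [q] enumerates the pairs of an index and a rational complex number; rational
   numbers outside of the disk are replaced by its center *)
pose q n : nat * (rat * rat) := odflt (0%N, (0, 0)) (unpickle n).
pose disk_point n : R[i] := let w := (ratr (q n).2.1 +i* ratr (q n).2.2)%C in
  if normc w < eps then w else 0.
have disk_pointP n : normc (disk_point n) < eps.
  by rewrite /disk_point; case: ifP => //; rewrite normc0.
apply: (@coefficientwise_cont_fq_le _ _ _ _ _
  (fun n w => w + disk_point n) (fun n => (q n).1)) => [n|a t _].
  by apply: nonexpansive_continuous => x y; rewrite /= opprD addrACA subrr addr0.
rewrite pseudospectrum_diag// spectrum_diag; set U := [set z | _].
suff -> : closure U = closure (range (fun n => a (q n).1 + disk_point n)) by [].
apply/seteqP; split; last first.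
  apply: closureS => _ [n _ <-]; exists (q n).1.
  by rewrite opprD addNKr normcN.
rewrite [X in _ `<=` X](closure_id _).1; last exact: closed_closure.
apply: closureS => z [j zj]; apply/closure_normcP => e e0.
have ej0 : 0 < eps - normc (a j - z) by rewrite subr_gt0.
have [|p1 [p2 zp]] := @rational_complex_dense R (z - a j) (Num.min e (eps - normc (a j - z))).
  by rewrite lt_min e0.
move: zp; set w := (_ +i* _)%C; rewrite lt_min => /andP[zpe zpeps].
exists (a j + w); last by rewrite opprD addrA.
have weps : normc w < eps.
  rewrite -[w]opprK normcN -[- w]add0r.
  rewrite (le_lt_trans (normc_distD (z - a j) _ _))// sub0r opprB.
  by rewrite -ltrBrDl.
have qE : q (pickle (j, (p1, p2))) = (j, (p1, p2)) by rewrite /q pickleK.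
by exists (pickle (j, (p1, p2))) => //; rewrite /disk_point qE -/w weps.
Qed.

Unset Implicit Arguments.

Theorem theorem6p1 (R : realType) (J : set R) (r : approximants J) (eps : R)
    (J_interval : is_interval J) (J_compact : compact J)
    (J_nonempty_interior : J° !=set0) (eps_gt0 : 0 < eps) :
  cont_fq_equiv (spectrum_problem r) (pseudospectrum_problem r eps).
Proof.
by split; [exact: spectrum_le_pseudospectrum|exact: pseudospectrum_le_spectrum].
Qed.
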